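(* For $n\ge1$ let $a_n$ be the number of $n\times n$ permutation matrices containing no mutable cell (equivalently, the number of placements of $n$ mutually non-attacking kings on an $n\times n$ chessboard with one king in each row and each column). Then \[a_n=(-1)^n\sum_{m=1}^n m!\,(-2)^m\sum_{\pi\in\mathcal{C}_{n,m}}\frac{1}{2^{\pi_1}}=(-1)^n\sum_{\pi\in\mathcal{C}_n}\frac{\ell(\pi)!\,(-2)^{\ell(\pi)}}{2^{\pi_1}}.\]
   Context: A cell of a $0$-$1$ matrix is mutable if it contains $0$ and at least two of its orthogonal neighbours (north, south, east, west) contain $1$. $\mathcal{C}_n$ is the set of compositions of $n$ (ordered tuples of positive integers summing to $n$) and $\mathcal{C}_{n,m}$ the set of those with exactly $m$ parts. For a composition $\pi$, $\ell(\pi)$ is its number of parts and $\pi_1$ denotes the number of parts of $\pi$ equal to $1$ (not the first part). *)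

(* Defs.v *)
From mathcomp Require Import all_boot all_order all_fingroup all_algebra.

Set Implicit Arguments.
Unset Strict Implicit.
Unset Printing Implicit Defensive.

Local Open Scope nat_scope.

Definition cell (n : nat) : finType := ('I_n * 'I_n)%type.

Definition orth_adjacent n (c d : cell n) : bool :=
  (c.1 == d.1) && ((c.2.+1 == d.2 :> nat) || (d.2.+1 == c.2 :> nat))
  || (c.2 == d.2) && ((c.1.+1 == d.1 :> nat) || (d.1.+1 == c.1 :> nat)).

(* A 0-1 matrix is a matrix over bool, whose ring structure has 0 = false and
   1 = true; hence is_perm_mx applies to it directly. *)
Definition mutable n (A : 'M[bool]_n) (c : cell n) : bool :=
  ~~ A c.1 c.2 &&
  (2 <= #|[set d : cell n | orth_adjacent c d && A d.1 d.2]|).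

Definition num_immutable_perm_mx (n : nat) : nat :=
  #|[set A : 'M[bool]_n | is_perm_mx A && [forall c : cell n, ~~ mutable A c]]|.

Definition king_attacks n (c d : cell n) : bool :=
  [&& c != d, c.1 <= d.1.+1, d.1 <= c.1.+1, c.2 <= d.2.+1 & d.2 <= c.2.+1].

Definition king_placement n (K : {set cell n}) : bool :=
  [&& #|K| == n,
      [forall i : 'I_n, #|[set c in K | c.1 == i]| == 1],
      [forall j : 'I_n, #|[set c in K | c.2 == j]| == 1]
    & [forall c in K, forall d in K, ~~ king_attacks c d]].

Definition num_king_placements (n : nat) : nat :=
  #|[set K : {set cell n} | king_placement K]|.

(* A composition of n has at most n parts, each at most n, so bounded sequences
   over 'I_n.+1 lose nothing and give a finite type. *)
Definition parts n (p : {bseq n of 'I_n.+1}) : seq nat := map val p.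

Definition compositions (n : nat) : {set {bseq n of 'I_n.+1}} :=
  [set p | all (fun k => 0 < k) (parts p) && (sumn (parts p) == n)].

Definition num_parts n (p : {bseq n of 'I_n.+1}) : nat := size (parts p).

Definition compositions_len (n m : nat) : {set {bseq n of 'I_n.+1}} :=
  [set p in compositions n | num_parts p == m].

Definition num_ones n (p : {bseq n of 'I_n.+1}) : nat := count_mem 1 (parts p).

(* Main.v *)
(* A cell of a permutation matrix is mutable exactly when it has one horizontal
   and one vertical neighbour equal to 1, i.e. when two 1s are diagonally
   adjacent.  Both counts are therefore the number of permutations s with
   |s(i+1) - s(i)| <> 1 for all i.  Inclusion-exclusion over sets of marked
   positions i at which |s(i+1) - s(i)| = 1 reduces the formula to: if the marks
   cut the word of s into m blocks, r of them of size 1, then m! 2^(m-r)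
   permutations satisfy all the marks.  This follows by induction, prepending a
   value j to a permutation word and shifting the values >= j up.  If the new
   first position is unmarked, j must only avoid separating a marked pair of
   consecutive values, which leaves one choice per block of the enlarged word;
   if it is marked, j must be adjacent to the old first value, which leaves two
   choices when that value was a block of its own and one choice otherwise. *)
Require Import Defs.
From mathcomp Require Import all_boot all_order all_fingroup all_algebra.
From mathcomp Require Import zify ring.

Import GRing.Theory.
Local Open Scope nat_scope.

(** * Marked words and the effect of inserting a value *)

Definition adj (x y : nat) : bool := (x.+1 == y) || (y.+1 == x).

(** Shifting by [bump j] opens a gap at the value [j]: it separates two consecutive values exactly
    when [j] is the larger one, and never makes non-adjacent values adjacent. *)
Lemma adj_bump j x y : x != y ->
  adj (bump j x) (bump j y) = adj x y && (j != maxn x y).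
Proof. rewrite /adj /bump; lia. Qed.

Lemma adj_bump_self j x : adj j (bump j x) = (j == x) || (j == x.+1).
Proof. rewrite /adj /bump; lia. Qed.

Definition nonadj : rel nat := fun x y => ~~ adj x y.

Fixpoint marked (b : bitseq) (t : seq nat) : bool :=
  if b is m :: b' then
    if t is x :: t' then
      (if t' is y :: _ then m ==> adj x y else true) && marked b' t'
    else true
  else true.

(* The values that cannot be inserted without separating a marked pair. *)
Fixpoint blocked (b : bitseq) (t : seq nat) : seq nat :=
  if b is m :: b' then
    if t is x :: t' then
      (if t' is y :: _ then nseq m (maxn x y) else [::]) ++ blocked b' t'
    else [::]
  else [::].

Lemma marked_bump b t j : uniq t ->
  marked b [seq bump j x | x <- t] = marked b t && (j \notin blocked b t).
Proof.
elim: t b => [|x t IH] [|m b] //= /andP[xt ut].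
rewrite IH // mem_cat negb_or.
case: t xt {IH ut} => [|y t] //=; rewrite inE negb_or => /andP[xy _].
rewrite adj_bump // mem_nseq.
by case: m; rewrite /= ?andbT //; case: (adj x y) => //=; rewrite andbCA.
Qed.

(** A blocked value is the larger member of a marked pair of consecutive values. *)
Lemma blocked_sub b t z : marked b t -> z \in blocked b t ->
  [/\ 0 < z, z \in t & z.-1 \in t].
Proof.
elim: t b => [|x t IH] [|m b] //= /andP[mx mt].
rewrite mem_cat => /orP[|/(IH _ mt)[-> zt zt']]; last first.
  by rewrite !inE zt zt' !orbT.
case: t mx {IH mt} => [|y t] //= mx.
rewrite mem_nseq => /andP[m0 /eqP->]; case: m mx m0 => //=.
by rewrite !inE /adj => mx _; split; lia.
Qed.

Lemma notin_blocked b x t : x \notin t -> marked b t ->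
  (x \notin blocked b t) && (x.+1 \notin blocked b t).
Proof.
move=> xt mt; apply/andP; split; apply/negP=> /(blocked_sub _ _ _ mt)[_].
  by rewrite (negPf xt).
by rewrite /= (negPf xt).
Qed.

(** The first pair can block only [x] or [x.+1]; since [x] does not recur, no later pair blocks
    either. So the length of [blocked] really counts the forbidden values. *)
Lemma uniq_blocked b t : uniq t -> marked b t -> uniq (blocked b t).
Proof.
elim: t b => [|x t IH] [|m b] //= /andP[xt ut] /andP[mx mt].
case: t xt mx IH ut mt => [|y t] //= xt mx IH ut mt; first exact: IH.
case: m mx => /= mx; last exact: IH.
rewrite IH // andbT.
have /andP[nx nx1] := notin_blocked _ _ _ xt mt.
by move: mx; rewrite /adj => /orP[]/eqP E;
   [rewrite (_ : maxn x y = x.+1)|rewrite (_ : maxn x y = x)] => //; lia.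
Qed.

Lemma size_blocked b t : size b < size t -> size (blocked b t) = count id b.
Proof.
elim: t b => [|x t IH] [|m b] //= sb; rewrite size_cat IH //.
by case: t sb {IH} => //= y t _; rewrite size_nseq.
Qed.

(** * Permutation words, generated by insertion at the front *)

Fixpoint perm_seqs (n : nat) : seq (seq nat) :=
  if n is n'.+1 then
    [seq j :: [seq bump j x | x <- t] | t <- perm_seqs n', j <- iota 0 n'.+1]
  else [:: [::]].

Lemma perm_seqsS n : perm_seqs n.+1 =
  [seq j :: [seq bump j x | x <- t] | t <- perm_seqs n, j <- iota 0 n.+1].
Proof. by []. Qed.

Lemma perm_seqsP n t :
  (t \in perm_seqs n) = [&& size t == n, uniq t & all (gtn n) t].
Proof.
elim: n t => [|n IH] t; first by rewrite inE; case: t.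
rewrite perm_seqsS.
apply/allpairsPdep/idP => [[u [j []]]|].
  rewrite IH mem_iota add0n => /and3P[/eqP su uu /allP au] jn ->.
  rewrite /= size_map su eqxx /= (map_inj_uniq (can_inj (@bumpK j))) uu andbT.
  have jn' : j < n.+1 by lia.
  rewrite jn' /= ; apply/andP; split.
    by apply/mapP=> -[x _]; rewrite /bump; lia.
  by apply/allP=> _ /mapP[x /au /= xn ->]; rewrite /bump; lia.
case: t => [|j t] //= /and3P[st /andP[jt ut] /andP[jn /allP at_]].
have nj x : x \in t -> x != j by move=> xt; apply: contraNneq jt => <-.
have tE : [seq bump j x | x <- [seq unbump j x | x <- t]] = t.
  rewrite -map_comp -[RHS]map_id; apply/eq_in_map => x xt /=.
  by apply: unbumpK; rewrite inE nj.
exists [seq unbump j x | x <- t], j.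
split; [|by rewrite (mem_iota 0 n.+1)|by rewrite tE].
  rewrite IH size_map -eqSS st /=; apply/andP; split.
    by rewrite -(map_inj_uniq (can_inj (@bumpK j))) tE.
  apply/allP=> _ /mapP[x xt ->] /=.
  by have /= := at_ _ xt; have := nj _ xt; rewrite /unbump; lia.
Qed.

Lemma perm_seqs_uniq n : uniq (perm_seqs n).
Proof.
elim: n => // n IH; rewrite perm_seqsS.
apply: allpairs_uniq => //; first exact: iota_uniq.
by move=> [u j] [v k] _ _ /= [->] /(inj_map (can_inj (@bumpK k))) ->.
Qed.

(** * Number of words satisfying prescribed marks *)

Lemma count_perm_seqsS (P Q : pred (seq nat)) c n :
    (forall t, t \in perm_seqs n ->
      count (fun j => P (j :: [seq bump j x | x <- t])) (iota 0 n.+1)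
      = if Q t then c else 0) ->
  count P (perm_seqs n.+1) = c * count Q (perm_seqs n).
Proof.
move=> PQ; rewrite -[LHS]sum1_count [LHS]big_mkcond perm_seqsS big_allpairs_dep.
rewrite (eq_big_seq (fun t => if Q t then c else 0)) => [|t /PQ <-]; last first.
  by rewrite -sum1_count [RHS]big_mkcond.
by rewrite -big_mkcond big_const_seq iter_addn_0.
Qed.

Lemma count_notin (s : seq nat) n : uniq s -> all (gtn n) s ->
  count (fun j => j \notin s) (iota 0 n) = n - size s.
Proof.
move=> us /allP ls; rewrite -[in RHS](size_iota 0 n) -(count_predC (mem s)).
suff -> : count (mem s) (iota 0 n) = size s by rewrite addKn.
rewrite -size_filter; apply/perm_size/uniq_perm => //.
  by rewrite filter_uniq // iota_uniq.
move=> x; rewrite mem_filter mem_iota /= add0n.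
by case xs: (x \in s) => //=; have := ls _ xs; rewrite /= => ->.
Qed.

Lemma count_pair (P : pred nat) x n : x.+1 < n ->
  count (fun j => ((j == x) || (j == x.+1)) && P j) (iota 0 n) = P x + P x.+1.
Proof.
move=> xn; have -> : n = x + (2 + (n - x.+2)) by lia.
rewrite !iotaD !count_cat /= add0n eqxx eqxx orbT /= addn0.
have H a k : (forall j, a <= j < a + k -> (j == x) || (j == x.+1) = false) ->
   count (fun j => ((j == x) || (j == x.+1)) && P j) (iota a k) = 0.
  move=> h; rewrite (@eq_in_count _ _ pred0) ?count_pred0 // => j.
  by rewrite mem_iota => /h /= ->.
rewrite !H ?addn0 // => j; lia.
Qed.

Lemma count_marked_false b : let n := (size b).+1 in
  count (marked (false :: b)) (perm_seqs n.+1)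
  = (n.+1 - count id b) * count (marked b) (perm_seqs n).
Proof.
move=> n; apply: count_perm_seqsS => t.
rewrite perm_seqsP => /and3P[/eqP st ut lt].
rewrite (@eq_count _ _ (fun j => marked b t && (j \notin blocked b t))).
  case: ifP => mt; last by rewrite count_pred0.
  rewrite count_notin ?size_blocked ?st ?uniq_blocked //.
  apply/allP=> z /(blocked_sub _ _ _ mt)[_ zt _].
  by have := allP lt _ zt; rewrite /=; lia.
by move=> j; rewrite -marked_bump //; case: t {st ut lt} => //=.
Qed.

Lemma count_marked_true b : let n := (size b).+1 in
  count (marked (true :: b)) (perm_seqs n.+1)
  = (2 - head false b) * count (marked b) (perm_seqs n).
Proof.
move=> n; apply: count_perm_seqsS => t.
rewrite perm_seqsP => /and3P[/eqP st ut lt].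
case: t st ut lt => // x t st ut lt.
rewrite (@eq_count _ _ (fun j => ((j == x) || (j == x.+1)) &&
   (marked b (x :: t) && (j \notin blocked b (x :: t))))); last first.
  by move=> j; rewrite -marked_bump // -adj_bump_self.
rewrite (count_pair
           (fun j => marked b (x :: t) && (j \notin blocked b (x :: t))));
  last by case/andP: lt => /=; lia.
case: ifP => //= mt; case: b @n mt st lt => [|m b] //= /andP[mx mt] st _.
case: t mx mt st ut => [|y t] //= mx mt [st] /andP[xt ut].
(* The candidates are [x] and [x.+1], and the later pairs block neither. Only the leading bit [m]
   can exclude one, namely [maxn x y], which is one of the two as [x] and [y] are then adjacent. *)
have /andP[nx nx1] := notin_blocked _ _ _ xt mt.
rewrite !mem_cat (negPf nx) (negPf nx1) !orbF !mem_nseq.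
by case: m mx => //=; rewrite /adj; lia.
Qed.

(** * Block lengths of a mark pattern *)

(* Position i is marked when positions i and i+1 share a block. *)
Fixpoint blocks (b : bitseq) : seq nat :=
  match b with
  | [::] => [:: 1]
  | false :: b' => 1 :: blocks b'
  | true :: b' => (head 0 (blocks b')).+1 :: behead (blocks b')
  end.

Lemma blocks_cons b :
  exists h q, blocks b = h.+1 :: q /\ (h == 0) = ~~ head false b.
Proof.
elim: b => [|[] b [h [q [E _]]]]; [by exists 0, [::]| |by exists 0, (blocks b)].
by exists h.+1, q; rewrite /= E.
Qed.

Lemma blocks_gt0 b : all (leq 1) (blocks b).
Proof.
by elim: b => [|[] b] //=; have [h [q [-> _]]] := blocks_cons b.
Qed.

Lemma sumn_blocks b : sumn (blocks b) = (size b).+1.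
Proof.
by elim: b => [|[] b] //=; have [h [q [-> _]]] := blocks_cons b;
  rewrite //= => <-.
Qed.

Lemma size_blocks b : size (blocks b) + count id b = (size b).+1.
Proof.
by elim: b => [|[] b] //=; have [h [q [-> _]]] := blocks_cons b => /=; lia.
Qed.

(** This is the count m! 2^(m-r), with 2^r moved to the left to avoid a subtraction in the
    exponent. *)
Lemma count_marked b :
  count (marked b) (perm_seqs (size b).+1) * 2 ^ count_mem 1 (blocks b)
  = (size (blocks b))`! * 2 ^ size (blocks b).
Proof.
elim: b => // -[] b.
  rewrite [size (_ :: b)]/= count_marked_true.
  move: (count _ (perm_seqs _)) => N.
  rewrite [blocks (_ :: b)]/=; have [h [q [-> /= ]]] := blocks_cons b.
  rewrite !eqSS => ->.
  (* Extending the first block keeps the number of blocks; the insertion factor is 2 exactly when a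
     singleton disappears, which offsets the power of 2 lost on the left. *)
  by case: (head false b); rewrite ?add0n ?add1n ?expnS; lia.
rewrite [size (_ :: b)]/= count_marked_false.
have -> : (size b).+2 - count id b = (size (blocks b)).+1.
  by have := size_blocks b; lia.
move: (count _ (perm_seqs _)) => N IH.
rewrite /= factS expnS add1n expnS.
by rewrite [LHS](_ : _ =
    (size (blocks b)).+1 * 2 * (N * 2 ^ count_mem 1 (blocks b)));
  [rewrite IH; ring | ring].
Qed.

(** An inverse of [blocks]: each block opens with [false] and continues with [true], the extra
    leading [false] opening the first block. *)
Lemma flatten_blocks b :
  flatten [seq false :: nseq k.-1 true | k <- blocks b] = false :: b.
Proof.
elim: b => [|[] b IH] //=; last by rewrite IH.
have [h [q [E _]]] := blocks_cons b.
by move: IH; rewrite E /= => -[<-].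
Qed.

Lemma blocks_inj : injective blocks.
Proof.
by move=> b c E; have := flatten_blocks b; rewrite E flatten_blocks => -[].
Qed.

Lemma blocks_surj q : all (leq 1) q -> 0 < size q -> exists b, blocks b = q.
Proof.
elim: q => [|[|k] q IH] //= /IH{}IH _.
(* It suffices to realise a first part 1, since [k] further true bits in front enlarge it to
   [k.+1]. *)
have [c Ec] : exists c, blocks c = 1 :: q.
  case: q IH => [|x q] IH; first by exists [::].
  by have [//|b <-] := IH; exists (false :: b).
by exists (nseq k true ++ c); elim: k => //= k ->.
Qed.

(** * Mark patterns of fixed length and compositions *)

Fixpoint bits (n : nat) : seq bitseq :=
  if n is n'.+1 then map (cons true) (bits n') ++ map (cons false) (bits n')
  else [:: [::]].

Lemma mem_bits n b : (b \in bits n) = (size b == n).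
Proof.
elim: n b => [|n IH] b; first by rewrite inE; case: b.
rewrite mem_cat; case: b => [|m b].
  by apply/negbTE; rewrite negb_or; apply/andP; split; apply/mapP=> -[].
rewrite eqSS -IH; apply/orP/idP => [[] /mapP[c cn [_ ->]] //|bn].
by case: m; [left|right]; apply: map_f.
Qed.

Lemma bits_uniq n : uniq (bits n).
Proof.
elim: n => //= n IH; rewrite cat_uniq !map_inj_uniq ?IH ?andbT //=;
  try by move=> ? ? [].
by apply/hasPn=> _ /mapP[b _ ->]; apply/mapP=> -[].
Qed.

Lemma mem_blocks_bits n q :
  (q \in map blocks (bits n)) = all (leq 1) q && (sumn q == n.+1).
Proof.
apply/mapP/andP => [[b]|[q0 /eqP sq]].
  by rewrite mem_bits => /eqP <- ->; rewrite blocks_gt0 sumn_blocks.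
have [|b qE] := blocks_surj _ q0; first by case: q {q0} sq.
by exists b => //; rewrite mem_bits -eqSS -sumn_blocks qE sq.
Qed.

(** * Permutations in one-line notation *)

Definition perm_word n (s : 'S_n) : seq nat := [seq val (s i) | i <- enum 'I_n].

Lemma size_perm_word n (s : 'S_n) : size (perm_word n s) = n.
Proof. by rewrite size_map size_enum_ord. Qed.

Lemma nth_perm_word n (s : 'S_n) (i : 'I_n) : nth 0 (perm_word n s) i = s i.
Proof. by rewrite (nth_map i) ?size_enum_ord // nth_ord_enum. Qed.

Lemma perm_word_inj n : injective (perm_word n).
Proof.
move=> s t E; apply/permP=> i; apply: val_inj.
by rewrite /= -!nth_perm_word E.
Qed.

Lemma size_perm_seqs n : size (perm_seqs n) = n`!.
Proof.
elim: n => // n IH.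
by rewrite perm_seqsS size_allpairs size_iota IH factS mulnC.
Qed.

Lemma perm_eq_words n :
  perm_eq [seq perm_word n s | s <- enum {perm 'I_n}] (perm_seqs n).
Proof.
have u : uniq [seq perm_word n s | s <- enum {perm 'I_n}].
  by rewrite map_inj_uniq ?enum_uniq //; apply: perm_word_inj.
have sub : {subset [seq perm_word n s | s <- enum {perm 'I_n}] <= perm_seqs n}.
  move=> _ /mapP[s _ ->]; rewrite perm_seqsP size_perm_word eqxx /=.
  rewrite map_inj_uniq ?enum_uniq /=; last by move=> i j /val_inj /perm_inj.
  by apply/allP=> _ /mapP[i _ ->] /=.
apply: uniq_perm => //; first exact: perm_seqs_uniq.
(* The words of permutations are distinct and number [n!], so the inclusion is an equality. *)
apply: (uniq_min_size u sub _).2.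
by rewrite size_perm_seqs size_map -cardT card_Sn.
Qed.

Lemma sorted_perm_word n (s : 'S_n) :
  reflect (forall i j : 'I_n, i.+1 = j -> ~~ adj (s i) (s j))
          (sorted nonadj (perm_word n s)).
Proof.
apply: (iffP (sortedP 0)) => [h i j ij|h i]; last first.
  rewrite size_perm_word => lin; have lin' := ltnW lin.
  by have := h (Ordinal lin') (Ordinal lin) erefl; rewrite -!nth_perm_word.
have := h i; rewrite size_perm_word ij /= !nth_perm_word; apply.
exact: ltn_ord.
Qed.

Lemma sum_blocks (R : nmodType) n (G : seq nat -> R) :
  (\sum_(p in compositions n.+1) G (parts p)
   = \sum_(b <- bits n) G (blocks b))%R.
Proof.
rewrite -big_enum -(big_map (@parts n.+1) xpredT G) -(big_map blocks xpredT G).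
apply/perm_big/uniq_perm.
- rewrite map_inj_uniq ?enum_uniq // => p r /(inj_map val_inj).
  exact: val_inj.
- by rewrite (map_inj_uniq blocks_inj) bits_uniq.
move=> q; rewrite mem_blocks_bits; apply/mapP/idP => [[p]|].
  by rewrite mem_enum inE => pc ->.
move=> /andP[q0 /eqP sq].
(* A composition of [n.+1] has at most [n.+1] parts, each below [n.+2]; hence it fits the bounded
   type and [inord] alters no part. *)
have sz : forall r, all (leq 1) r -> size r <= sumn r.
  by elim=> //= k r IH /andP[k0 /IH]; lia.
have le : forall k, k \in q -> k < n.+2.
  by move=> k /(perm_to_rem) /perm_sumn /=; lia.
have sq' : size [seq (inord k : 'I_n.+2) | k <- q] <= n.+1.
  by rewrite size_map -sq sz.
have pq : parts (Bseq sq') = q.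
  rewrite /parts /= -map_comp -[RHS]map_id; apply/eq_in_map => k /le kn /=.
  by rewrite inordK.
by exists (Bseq sq') => //; rewrite mem_enum inE pq q0 sq eqxx.
Qed.

(** * Mutable cells of permutation matrices *)

Lemma num_immutable_perm_mxE n :
  num_immutable_perm_mx n = #|[set s : 'S_n | sorted nonadj (perm_word n s)]|.
Proof.
have pE (s : 'S_n) i j : (perm_mx s : 'M[bool]_n) i j = (s i == j).
  by rewrite !mxE; case: eqP.
rewrite -(card_imset _ (_ : injective (@perm_mx bool n))); last first.
  move=> s t /matrixP E; apply/permP=> i.
  by have := E i (t i); rewrite !pE eqxx => /eqP.
apply: eq_card => A; rewrite inE; apply/andP/imsetP => [[]|[s]].
  move=> /is_perm_mxP[s ->] /forallP im; exists s => //.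
  rewrite inE; apply/sorted_perm_word => i j ij; apply/negP=> aij.
  (* The cell [(i, s j)] is a corner of the 2 by 2 square whose diagonal carries the ones [(i, s i)]
     and [(j, s j)]. *)
  have /negP[] := im (i, s j); rewrite /mutable pE /=.
  have nij : i != j by apply: contra_eq_neq ij => ->; lia.
  rewrite (inj_eq perm_inj) nij /=; apply/card_gt1P.
  exists (i, s i), (j, s j); rewrite !inE !pE /= !eqxx /orth_adjacent /= !eqxx.
  split; [by move: aij; rewrite /adj; lia | by rewrite ij eqxx orbT |].
  by rewrite xpair_eqE (negPf nij).
rewrite inE => /sorted_perm_word na ->; split; first exact: perm_mx_is_perm.
apply/forallP=> -[a b]; rewrite /mutable /= pE; apply/negP=> /andP[sab].
(* A horizontal neighbour in row [d1] and a vertical one in row [e1] give adjacent rows with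
   adjacent values. Two neighbours of the same kind would share a row or a column, hence
   coincide. *)
have key (d1 e1 : 'I_n) :
    a = d1 -> b = s e1 -> adj b (s d1) -> adj a e1 -> False.
  move=> <- -> h /orP[] /eqP h'.
    by have := na _ _ h'; move: h; rewrite /adj; lia.
  by have := na _ _ h'; rewrite h.
move=> /card_gt1P[[d1 d2] [[e1 e2] []]]; rewrite !inE !pE /= /orth_adjacent /=.
move=> /andP[hd /eqP Ed] /andP[he /eqP Ee]; move: hd he.
rewrite -Ed -Ee xpair_eqE => /orP[] /andP[/eqP d Hd] /orP[] /andP[/eqP e He].
- by subst; rewrite !eqxx.
- by move=> _; apply: (key d1 e1 d e Hd He).
- by move=> _; apply: (key e1 d1 e d He Hd).
- by rewrite -(inj_eq (@perm_inj _ s)) -d -e eqxx.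
Qed.

(** * Placements of non-attacking kings *)

Definition perm_cells n (s : 'S_n) : {set cell n} := [set c | s c.1 == c.2].

Lemma perm_cells_inj n : injective (@perm_cells n).
Proof.
move=> s t /setP E; apply/permP=> i.
by have := E (i, t i); rewrite !inE /= eqxx => /eqP.
Qed.

(** Distinct ones of a permutation differ in both coordinates, so distance at most 1 means exactly 1
    in each. *)
Lemma king_attacks_adj n (s : 'S_n) (i j : 'I_n) :
  king_attacks (i, s i) (j, s j) = adj i j && adj (s i) (s j).
Proof.
rewrite /king_attacks /adj /= xpair_eqE (inj_eq perm_inj) andbb.
case: (eqVneq i j) => [->|nij] /=; first lia.
have nij' : (i : nat) != j by rewrite (inj_eq val_inj).
have nsij : (s i : nat) != s j by rewrite (inj_eq val_inj) (inj_eq perm_inj).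
lia.
Qed.

Lemma perm_cells_rook n (s : 'S_n) :
  [/\ #|perm_cells n s| = n,
      forall i, #|[set c in perm_cells n s | c.1 == i]| = 1
    & forall j, #|[set c in perm_cells n s | c.2 == j]| = 1].
Proof.
split=> [|i|j].
- rewrite -[RHS]card_ord -(card_imset _ (_ : injective (fun i => (i, s i)))).
  2: by move=> i j [].
  apply: eq_card => -[a b]; rewrite inE /=.
  by apply/eqP/imsetP => [<-|[i _ [-> ->]]] //; exists a.
- rewrite -(cards1 (i, s i)); apply: eq_card => -[a b].
  rewrite !inE xpair_eqE /=.
  by case: (eqVneq a i) => [->|]; rewrite ?andbF ?andbT // eq_sym.
rewrite -(cards1 ((s^-1)%g j, j)); apply: eq_card => -[a b].
rewrite !inE xpair_eqE /=.
case: (eqVneq b j) => [->|]; rewrite ?andbF ?andbT //.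
by apply/eqP/eqP => [<-|->]; rewrite ?permK ?permKV.
Qed.

(** The row condition defines a function, and the column condition makes it injective. *)
Lemma rook_perm_cells n (K : {set cell n}) :
  (forall i, #|[set c in K | c.1 == i]| = 1) ->
  (forall j, #|[set c in K | c.2 == j]| = 1) ->
  exists s, K = perm_cells n s.
Proof.
move=> row col.
have uniq1 (P : pred (cell n)) : #|[set c in K | P c]| = 1 ->
    exists2 c, c \in K & P c /\ forall d, d \in K -> P d -> d = c.
  move/eqP/cards1P=> [c /setP E].
  have := E c; rewrite !inE eqxx => /andP[cK Pc].
  exists c => //; split=> // d dK Pd.
  by have := E d; rewrite !inE dK Pd => /esym/eqP.
have exf i : exists j, (i, j) \in K.
  by have [[a b] abK [/= /eqP <- _]] := uniq1 _ (row i); exists b.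
pose f i := xchoose (exf i).
have fK i : (i, f i) \in K by apply: (xchooseP (exf i)).
have finj : injective f.
  move=> i j E; have [c _ [_ h]] := uniq1 _ (col (f i)).
  by have := h _ (fK j); rewrite -(h _ (fK i)) //= E => /(_ (eqxx _)) [].
exists (perm finj); apply/setP=> -[a b]; rewrite inE /= permE.
have [c _ [_ h]] := uniq1 _ (row a).
apply/idP/eqP => [abK|<-] //.
by have := h _ abK (eqxx _); rewrite -(h _ (fK a)) //= => -[].
Qed.

Lemma num_king_placementsE n :
  num_king_placements n = #|[set s : 'S_n | sorted nonadj (perm_word n s)]|.
Proof.
rewrite -(card_imset _ (@perm_cells_inj n)).
apply: eq_card => K; rewrite inE; apply/and4P/imsetP => [[_]|[s]].
  move=> /forallP row /forallP col /forall_inP nk.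
  have [s KE] := rook_perm_cells _ K (fun i => eqP (row i))
                                    (fun j => eqP (col j)).
  exists s => //; rewrite inE; apply/sorted_perm_word => i j ij.
  have is_K k : (k, s k) \in K by rewrite KE inE.
  have /forall_inP/(_ _ (is_K j)) := nk _ (is_K i).
  by rewrite king_attacks_adj /adj ij eqxx.
rewrite inE => /sorted_perm_word na ->.
have [sz row col] := perm_cells_rook _ s; split; first by rewrite sz.
- by apply/forallP=> i; rewrite row.
- by apply/forallP=> j; rewrite col.
apply/forall_inP=> -[a b]; rewrite inE /= => /eqP <-.
apply/forall_inP=> -[c d]; rewrite inE /= => /eqP <-.
rewrite king_attacks_adj; apply/negP=> /andP[/orP[]/eqP h]; apply/negP.
  exact: na h.
by have := na _ _ h; rewrite /adj orbC.
Qed.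

(** * Inclusion-exclusion and the final formula *)

Local Open Scope ring_scope.

(** Expansion of the product of the factors 1 - [adjacent] over consecutive pairs, a true bit
    selecting the subtracted term. *)
Lemma nonadj_expand (R : pzRingType) t : (0 < size t)%N ->
  (sorted nonadj t)%:R =
  \sum_(b <- bits (size t).-1) (-1) ^+ count id b * (marked b t)%:R :> R.
Proof.
elim: t => // x [|y t] IH _; first by rewrite big_seq1 mul1r.
rewrite [size _]/= [bits _]/= big_cat !big_map /=.
rewrite (_ : (_ && _) = nonadj x y && sorted nonadj (y :: t)) //.
have -> : (nonadj x y && sorted nonadj (y :: t))%:R =
    (1 - (adj x y)%:R) * (sorted nonadj (y :: t))%:R :> R.
  by rewrite /nonadj; case: (adj x y); rewrite ?subrr ?mul0r ?subr0 ?mul1r.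
rewrite IH // mulrBl mul1r addrC !mulr_sumr -sumrN.
congr (_ + _); apply: eq_bigr => b _.
rewrite exprD expr1 mulN1r mulNr; congr (- _).
by case: (adj x y); rewrite ?mul1r ?mul0r ?mulr0.
Qed.

Lemma natr_count (R : pzRingType) (T : Type) (P : pred T) s :
  (count P s)%:R = \sum_(x <- s) (P x)%:R :> R.
Proof.
by rewrite -sum1_count big_mkcond natr_sum; apply: eq_bigr => x _; case: (P x).
Qed.

Lemma num_immutable_perm_mx_count n :
  num_immutable_perm_mx n = count (sorted nonadj) (perm_seqs n).
Proof.
rewrite num_immutable_perm_mxE -(seq.permP (perm_eq_words n)) count_map.
rewrite cardE -size_filter {1}/enum_mem enumT; congr size.
by apply: eq_filter => s; rewrite /= inE.
Qed.

Lemma num_immutable_perm_mx_sum n :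
  (num_immutable_perm_mx n.+1)%:R =
  (-1) ^+ n.+1 * \sum_(p in compositions n.+1)
    ((num_parts p)`!)%:R * (-2) ^+ num_parts p / 2 ^+ num_ones p :> rat.
Proof.
rewrite (sum_blocks _ n (fun q =>
  ((size q)`!)%:R * (-2) ^+ size q / 2 ^+ count_mem 1%N q)).
rewrite num_immutable_perm_mx_count natr_count.
have -> : \sum_(t <- perm_seqs n.+1) (sorted nonadj t)%:R =
    \sum_(t <- perm_seqs n.+1) \sum_(b <- bits n)
      (-1) ^+ count id b * (marked b t)%:R :> rat.
  apply: eq_big_seq => t; rewrite perm_seqsP => /andP[/eqP st _].
  by rewrite nonadj_expand st.
rewrite exchange_big mulr_sumr; apply: eq_big_seq => b.
rewrite mem_bits => /eqP sb; rewrite -mulr_sumr -natr_count -sb.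
have nz : 2 ^+ count_mem 1%N (blocks b) != 0 :> rat by rewrite expf_neq0.
(* Clearing the denominator lets [count_marked] apply. The signs agree because blocks and marks
   together number [n.+1]. *)
apply: (mulIf nz); rewrite mulrA divfK // -mulrA -(natrX _ 2) -natrM.
rewrite count_marked -size_blocks natrM natrX -[- 2]mulN1r exprMn exprD.
have sq m : (-1) ^+ m * (-1) ^+ m = 1 :> rat by rewrite -expr2 sqrr_sign.
ring: (sq (size (blocks b))).
Qed.

Theorem theorem6p1 (n : nat) (hn : (1 <= n)%N) :
  [/\ num_immutable_perm_mx n = num_king_placements n,
      (num_immutable_perm_mx n)%:R
        = (-1) ^+ n * \sum_(1 <= m < n.+1)
            (m`!)%:R * (-2) ^+ m *
              \sum_(p in compositions_len n m) 1 / 2 ^+ num_ones p :> rat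
    & (-1) ^+ n * \sum_(1 <= m < n.+1)
            (m`!)%:R * (-2) ^+ m *
              \sum_(p in compositions_len n m) 1 / 2 ^+ num_ones p
        = (-1) ^+ n * \sum_(p in compositions n)
            ((num_parts p)`!)%:R * (-2) ^+ num_parts p / 2 ^+ num_ones p :> rat].
Proof.
have E : \sum_(1 <= m < n.+1) (m`!)%:R * (-2) ^+ m *
              \sum_(p in compositions_len n m) 1 / 2 ^+ num_ones p
     = \sum_(p in compositions n)
            ((num_parts p)`!)%:R * (-2) ^+ num_parts p / 2 ^+ num_ones p :> rat.
  under eq_bigr => m _.
    rewrite mulr_sumr.
    rewrite (eq_bigl (fun p => (p \in compositions n) && (m == num_parts p))).
      rewrite big_mkcondr; over.
    by move=> p; rewrite inE eq_sym.
  rewrite exchange_big; apply: eq_bigr => p; rewrite inE => /andP[_ /eqP sp].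
  rewrite -big_mkcond big_nat1_eq mulrA mulr1 ifT //.
  (* The number of parts lies in the summation range: at most [n] by the bound in the type, and
     nonzero because the sum [n] is positive. *)
  rewrite ltnS {2}/num_parts size_map size_bseq andbT /num_parts.
  by move: hn; rewrite -{1}sp; case: (parts p).
rewrite E num_king_placementsE -num_immutable_perm_mxE; split=> //.
by case: n hn {E} => // n _; apply: num_immutable_perm_mx_sum.
Qed.
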